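(* Let $C'>0$. There are constants $c,C>0$ depending only on $C'$ such that the following holds. Let $\mathcal{W}=\boldsymbol{w_1}\otimes\cdots\otimes\boldsymbol{w_n}\in\mathbb{R}^{d_1\times\cdots\times d_n}$ be a CP rank-1 tensor with strictly positive entries and $\|\mathcal{W}\|_\infty\leq1$, such that $$\max_{i_k}|\boldsymbol{w_k}(i_k)|\leq C'\min_{i_k}|\boldsymbol{w_k}(i_k)|\quad\text{for all }k=1,\dots,n.$$ Let $m=\|\mathcal{W}^{(1/2)}\|_F^2$. Suppose that we choose each $(i_1,\dots,i_n)\in[d_1]\times\cdots\times[d_n]$ independently with probability $\mathcal{W}_{i_1\cdots i_n}$ to form a set $\Omega\subseteq[d_1]\times\cdots\times[d_n]$. Then with probability at least $1-\exp(-C\cdot m)$ over the choice of $\Omega$, the following holds: Let $\sigma,\beta>0$ and let $K_{\boldsymbol{r}}\subseteq\mathbb{R}^{d_1\times\cdots\times d_n}$ be the cone of tensors with Tucker rank $\boldsymbol{r}=[r_1,\dots,r_n]$. For any (possibly randomized) algorithm $\mathcal{A}:\mathbb{R}^\Omega\to\mathbb{R}^{d_1\times\cdots\times d_n}$ that takes as input $\mathcal{T}_\Omega+\mathcal{Z}_\Omega$ and outputs a guess $\widehat{\mathcal{T}}$ for $\mathcal{T}$, for $\mathcal{T}\in K_{\boldsymbol{r}}\cap\beta\mathbf{B}_\infty$ and $\mathcal{Z}$ with i.i.d. entries $\mathcal{Z}_{i_1\cdots i_n}\sim\mathcal{N}(0,\sigma^2)$, there is some $\mathcal{T}\in K_{\boldsymbol{r}}\cap\beta\mathbf{B}_\infty$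 so that $$\frac{\|\mathcal{W}^{(1/2)}\boxdot(\mathcal{A}(\mathcal{T}_\Omega+\mathcal{Z}_\Omega)-\mathcal{T})\|_F}{\|\mathcal{W}^{(1/2)}\|_F}\geq c\cdot\min\left\{\frac{\beta}{\sqrt{\log\left(8\prod_{k=1}^nd_k\right)}},\ \frac{\sigma}{\sqrt{|\Omega|}}\sqrt{\prod_{k=1}^nr_k}\cdot M\right\}$$ with probability at least $\frac12$ over the randomness of $\mathcal{A}$ and the choice of $\mathcal{Z}$, where $$M=\min\left\{\sqrt{\frac{1}{\left(\prod_{k=1}^n\left(1+2C'^2\frac{r_k}{d_k}\right)\right)-1}},\ 1,\ \sqrt{\frac{1}{\left(\prod_{k=1}^n\left(2C'\sqrt{\frac{r_k}{d_k}\log(r_k)}+2C'\frac{r_k}{d_k}\log(r_k)+1\right)\right)-1}}\right\}.$$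
   Context: Notation. $[d]=\{1,\dots,d\}$. $\mathcal{X}_\Omega$ denotes the restriction of $\mathcal{X}$ to the entries in $\Omega$ (an element of $\mathbb{R}^\Omega$). $\boxdot$ is the entrywise (Hadamard) product and $\mathcal{X}^{(\alpha)}$ the entrywise power. $\|\cdot\|_F$ is the Frobenius norm, $\|\mathcal{X}\|_\infty=\max|\mathcal{X}_{i_1\cdots i_n}|$, and $\mathbf{B}_\infty$ is the unit ball of $\|\cdot\|_\infty$, so $\beta\mathbf{B}_\infty=\{\mathcal{X}:\|\mathcal{X}\|_\infty\leq\beta\}$. The outer product is $(\boldsymbol{a}_1\otimes\cdots\otimes\boldsymbol{a}_n)_{i_1\cdots i_n}=\prod_k\boldsymbol{a}_k(i_k)$; a CP rank-1 tensor is an outer product of $n$ vectors. The mode-$k$ unfolding $\mathcal{X}_{(k)}\in\mathbb{R}^{d_k\times\prod_{j\ne k}d_j}$ is the matrix whose columns are the vectors obtained from $\mathcal{X}$ by fixing all indices except the $k$-th; the Tucker rank of $\mathcal{X}$ is $(\operatorname{rank}\mathcal{X}_{(1)},\dots,\operatorname{rank}\mathcal{X}_{(n)})$. The cone $K_{\boldsymbol{r}}$ is the set of tensors $\mathcal{X}$ with $\operatorname{rank}(\mathcal{X}_{(k)})\leq r_k$ for all $k$. A positive number divided by $0$ is read as $+\infty$. *)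

(* Defs.v *)
From HB Require Import structures.
From mathcomp Require Export all_boot all_order all_algebra.
From mathcomp Require Export all_classical all_reals all_analysis.

#[export] Set Implicit Arguments.
#[export] Unset Strict Implicit.
#[export] Unset Printing Implicit Defensive.

Import Order.TTheory GRing.Theory Num.Theory.
Import numFieldNormedType.Exports.

Local Open Scope classical_set_scope.
Local Open Scope ring_scope.

Definition mindex (n : nat) (d : 'I_n -> nat) := {dffun forall k : 'I_n, 'I_(d k)}.

Definition tensor (R : Type) (n : nat) (d : 'I_n -> nat) := mindex d -> R.

Section Tensors.
Context {R : realType} {n : nat}.
Implicit Types d : 'I_n -> nat.

Definition outer d (w : forall k, 'I_(d k) -> R) : tensor R d :=
  fun i => \prod_k w k (i k).

Definition hpow d (X : tensor R d) (a : R) : tensor R d := fun i => X i `^ a.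

Definition frob d (X : tensor R d) : R := Num.sqrt (\sum_i X i ^+ 2).

Definition normoo d (X : tensor R d) : R := \big[Num.max/0]_i `|X i|.

Definition max_abs (p : nat) (v : 'I_p -> R) : R := \big[Num.max/0]_i `|v i|.

(* [max_abs v] is only the neutral element of the iterated minimum: it is an
   upper bound of all the [`|v i|], hence does not affect it when [0 < p]. *)
Definition min_abs (p : nat) (v : 'I_p -> R) : R :=
  \big[Num.min/max_abs v]_i `|v i|.

(* The multi-indices over all the modes but [k]; the modes [j != k] are the
   [lift k j'] for [j' : 'I_n.-1]. *)
Definition coindex d (k : 'I_n) :=
  {dffun forall j : 'I_n.-1, 'I_(d (lift k j))}.

(* The multi-index with [k]-th entry [a] and other entries given by [c]. *)
Definition insert d (k : 'I_n) (a : 'I_(d k)) (c : coindex d k) : mindex d :=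
  [ffun j => match unliftP k j with
             | UnliftSome j' e => cast_ord (congr1 d (esym e)) (c j')
             | UnliftNone e => cast_ord (congr1 d (esym e)) a
             end].

Definition unfolding d (k : 'I_n) (X : tensor R d) :
    'M[R]_(d k, #|{: coindex d k}|) :=
  \matrix_(a, c) X (insert a (enum_val c)).

Definition tucker_cone d (r : 'I_n -> nat) : set (tensor R d) :=
  [set X | forall k, (\rank (unfolding k X) <= r k)%N].

Definition ball_oo d (beta : R) : set (tensor R d) :=
  [set X | normoo X <= beta].

Definition observation d (Omega : {set mindex d}) :=
  {i : mindex d | i \in Omega} -> R.

Definition restr d (Omega : {set mindex d}) (X : tensor R d) :
  observation Omega := fun i => X (val i).

(* The probability that a random [Omega], containing each multi-index [i]
   independently with probability [W i], satisfies [E]. *)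
Definition sampling_prob d (W : tensor R d) (E : set {set mindex d}) : R :=
  \sum_(Omega | `[< E Omega >])
    ((\prod_(i in Omega) W i) * \prod_(i in ~: Omega) (1 - W i)).

Definition cylinders d (Omega : {set mindex d}) : set (set (observation Omega)) :=
  [set C | exists i (B : set R), measurable B /\
     C = (fun y : observation Omega => y i) @^-1` B].

(* A randomized algorithm takes a random seed in [S] and an observation;
   [observation Omega] is equipped with its product sigma-algebra. *)
Definition measurable_algorithm d (Omega : {set mindex d})
    (dS : measure_display) (S : measurableType dS)
    (A : S -> observation Omega -> tensor R d) :=
  forall i, measurable_fun [set: S * g_sigma_algebraType (@cylinders d Omega)]
    (fun sy => A sy.1 sy.2 i).

End Tensors.

Arguments restr {R n d} Omega X _.
Arguments tucker_cone {R n d} r _.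
Arguments ball_oo {R n d} beta _.

Section Noise.
Context {R : realType} {dN : measure_display} {N : measurableType dN}.
Context {P : probability N R}.
Local Open Scope ereal_scope.

Definition independent_RVs (I : finType) (Z : I -> {RV P >-> R}) :=
  forall (J : {set I}) (B : I -> set R), (forall i, measurable (B i)) ->
    P (\bigcap_(i in [set` J]) (Z i @^-1` B i)) =
    \prod_(i in J) P (Z i @^-1` B i).

Definition iid_gaussian (I : finType) (sigma : R) (Z : I -> {RV P >-> R}) :=
  independent_RVs Z /\
  forall i (B : set R), measurable B ->
    distribution P (Z i) B = normal_prob 0%R sigma B.

End Noise.

(* The inverses are those of the extended reals, with [0^-1 = +oo]. For [r k = 0]
   the convention [ln 0 = 0] gives [q k * l k = 0], the limit of [x * ln x]. *)
Definition Mfactor {R : realType} (C' : R) (n : nat) (d r : 'I_n -> nat) : \bar R :=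
  let q k : R := (r k)%:R / (d k)%:R in
  let l k : R := ln (r k)%:R in
  mine (sqrte (1 / (\prod_k (1 + 2 * C' ^+ 2 * q k) - 1)%:E))
    (mine 1
      (sqrte (1 / (\prod_k (2 * C' * Num.sqrt (q k * l k)
                            + 2 * C' * (q k * l k) + 1) - 1)%:E)))%E.

(* Main.v *)
Require Import Defs.
From HB Require Import structures.
From mathcomp Require Import measurable_realfun ring lra.

(** The lower bound holds for every [Omega], so that the sampling probability of
    the event is 1. Each mode [k] is cut greedily into [r k] classes of nearly
    equal [w k]-mass; the products of the classes are [\prod_k r k] blocks, each
    of [W]-mass at most [X = \prod_k (1 + 2 * C'^2 * r k / d k)] times the average,
    and a tensor which is constant on blocks has Tucker rank at most [r]. By
    counting, half of the [W]-mass lies in blocks with at most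
    [sigma^2 / tau^2] observations as soon as
    [2 * X * #|Omega| * tau^2 <= sigma^2 * \prod_k r k], and [Mfactor] is at most
    [sqrt (2 / X)]. On such a block the 64 levels [tau / 64 * a], [a < 64], cannot be
    told apart: the second moment of the likelihood ratio of the observations is
    at most [expR 1]. Hence for random levels every entry of these blocks is
    recovered within [tau / 128] with probability at most [1 / 4], and Markov's
    inequality applied to the recovered [W]-mass gives a loss of order [tau] with
    probability at least [1 / 2]. *)

Import Order.TTheory GRing.Theory Num.Theory.
Import numFieldNormedType.Exports.

Local Open Scope classical_set_scope.
Local Open Scope ring_scope.

(** * Densities and independence *)

Section Density.
Local Open Scope ereal_scope.
Context d (T : measurableType d) (R : realType).
Variables (mu : {measure set T -> \bar R}) (g : T -> R).
Hypotheses (mg : measurable_fun [set: T] g) (g0 : forall x, (0 <= g x)%R).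

(* The proofs are arguments of the definition so that the measure structure can be
   attached to it. *)
Definition with_density of measurable_fun [set: T] g & (forall x, (0 <= g x)%R) :=
  fun A => \int[mu]_(x in A) (g x)%:E.

Local Notation nu := (with_density mg g0).

Let nu0 : nu set0 = 0.
Proof. by rewrite /with_density integral_set0. Qed.

Let nu_ge0 A : 0 <= nu A.
Proof. by apply: integral_ge0 => x _; rewrite lee_fin. Qed.

Let nu_sigma_additive : semi_sigma_additive nu.
Proof.
move=> F mF tF mUF; rewrite /with_density ge0_integral_bigcup//.
- apply: is_cvg_ereal_nneg_natsum_cond => n _ _; exact: nu_ge0.
- exact/measurable_EFinP/measurable_funTS.
- by move=> x _; rewrite lee_fin.
Qed.

HB.instance Definition _ := isMeasure.Build _ _ _
  nu nu0 nu_ge0 nu_sigma_additive.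

Import HBNNSimple.

(** Both sides are monotone limits along the simple functions [f_ n], and for an indicator the
    identity is the definition of [with_density]. *)
Lemma ge0_integral_with_density (f : T -> \bar R) :
  measurable_fun [set: T] f -> (forall x, 0 <= f x) ->
  \int[nu]_x f x = \int[mu]_x (f x * (g x)%:E).
Proof.
move=> mf f0; pose f_ := nnsfun_approx measurableT mf.
have mEg : measurable_fun [set: T] (EFin \o g) by exact/measurable_EFinP.
have cvg_f x : (f_ n x)%:E @[n --> \oo] --> f x by apply: cvg_nnsfun_approx.
transitivity (limn (fun n => \int[nu]_x (f_ n x)%:E)).
  rewrite -monotone_convergence//.
  - by apply: eq_integral => y _; apply/esym/cvg_lim.
  - by move=> n; exact/measurable_EFinP/measurable_funP.
  - by move=> n y _; rewrite lee_fin.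
  - by move=> y _ m n mn; rewrite lee_fin; exact/lefP/nd_nnsfun_approx.
rewrite [X in limn X](_ : _ =
    (fun n => \int[mu]_x ((f_ n x)%:E * (g x)%:E))).
  rewrite -monotone_convergence//; last 3 first.
  - move=> n; apply: emeasurable_funM => //.
    exact/measurable_EFinP/measurable_funP.
  - by move=> n x _; rewrite mule_ge0// lee_fin.
  - move=> x _ m n mn; rewrite lee_wpmul2r// lee_fin//.
    exact/lefP/nd_nnsfun_approx.
  by apply: eq_integral => x _; apply/cvg_lim => //; exact: cvgeZr.
apply/funext => n.
transitivity (\sum_(k \in range (f_ n))
    \int[nu]_x (k * \1_(f_ n @^-1` [set k]) x)%:E).
  under eq_integral do rewrite fimfunE -fsumEFin//.
  rewrite ge0_integral_fsum//.
  - by move=> y; exact/measurable_EFinP/measurable_funM.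
  - by move=> y x _; rewrite nnfun_muleindic_ge0.
transitivity (\sum_(k \in range (f_ n))
    \int[mu]_x ((k * \1_(f_ n @^-1` [set k]) x)%:E * (g x)%:E)).
  apply: eq_fsbigr => r rf; rewrite integralZl_indic_nnsfun// integral_indic//=.
  have r0 : (0 <= r)%R by move: rf; rewrite inE/= => -[y _ <-].
  under [RHS]eq_integral do rewrite EFinM -muleA.
  rewrite ge0_integralZl//=; last 2 first.
  - by apply: emeasurable_funM => //; exact/measurable_EFinP.
  - by move=> x _; rewrite mule_ge0// lee_fin.
  rewrite /with_density setIT integral_mkcond; congr (_ * _).
  apply: eq_integral => x _; rewrite patchE indicE.
  by case: ifPn; rewrite ?mul1e ?mul0e.
rewrite -ge0_integral_fsum//.
- apply: eq_integral => x _; rewrite [in RHS]fimfunE -fsumEFin//.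
  by rewrite ge0_mule_fsuml// => r; rewrite nnfun_muleindic_ge0.
- by move=> r; apply: emeasurable_funM => //; exact/measurable_EFinP/measurable_funM.
- by move=> r x _; rewrite mule_ge0 ?nnfun_muleindic_ge0 ?lee_fin.
Qed.

End Density.

Section Independence.
Local Open Scope ereal_scope.
Context {R : realType} {dN : measure_display} {N : measurableType dN}.
Context {P : probability N R} {J : finType}.

(** The hypothesis on [B] says that [Y] pushes the measure of density [g] forward to [c] times the
    law of [Y]; equal measures give equal integrals of [f]. *)
Lemma ge0_integral_indep_scale (Y : {RV P >-> R}) (g : N -> R) (c : R) :
  measurable_fun [set: N] g -> (forall x, (0 <= g x)%R) -> (0 <= c)%R ->
  (forall B : set R, measurable B ->
    \int[P]_(x in Y @^-1` B) (g x)%:E = c%:E * P (Y @^-1` B)) ->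
  forall f : R -> R, measurable_fun [set: R] f -> (forall x, (0 <= f x)%R) ->
  \int[P]_x (f (Y x) * g x)%:E = c%:E * \int[P]_x (f (Y x))%:E.
Proof.
move=> mg g0 c0 gY f mf f0.
have mEf : measurable_fun [set: R] (EFin \o f) by exact/measurable_EFinP.
have Ef0 x : 0 <= (EFin \o f) x by rewrite lee_fin.
have mfY : measurable_fun [set: N] (EFin \o f \o Y) by exact: measurableT_comp.
under eq_integral do rewrite EFinM.
rewrite -(@ge0_integral_with_density _ _ _ P g mg g0 (EFin \o f \o Y))//; last first.
  by move=> x; rewrite lee_fin.
pose nu : {measure set N -> \bar R} := with_density P mg g0.
rewrite -(@ge0_integral_pushforward _ _ _ _ _ Y _ nu setT)//.
rewrite -(@ge0_integral_distribution _ _ _ _ _ P Y (EFin \o f))//.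
rewrite -(@ge0_integral_mscale _ _ _ (distribution P Y) setT measurableT (NngNum c0))//.
by apply: eq_measure_integral => B mB _; exact: gY.
Qed.

Lemma prod_indic (T : Type) (B : J -> set T) x :
  (\prod_j \1_(B j) x = \1_(\bigcap_(j in [set` [set: J]%SET]) B j) x :> R)%R.
Proof.
rewrite [RHS]indicE; have [/set_mem xB|xB] := boolP (x \in _).
  by rewrite big1// => j _; rewrite indicE mem_set//; apply: xB; rewrite /= inE.
have [j xBj] : exists j, x \notin B j.
  apply: contrapT => /forallNP xB'; move/negP: xB; apply.
  by rewrite inE => j _; have /negP/negPn/set_mem := xB' j.
by rewrite (bigD1 j)//= indicE (negbTE xBj) mul0r.
Qed.

(** Independence gives the identity for indicators. The factors become general functions one at a
    time through [ge0_integral_indep_scale]: the other factors form the weight, and the product of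
    their integrals, finite by assumption, is the constant. *)
Lemma integral_prod_indep (Y : J -> {RV P >-> R}) (f : J -> R -> R) :
  independent_RVs Y ->
  (forall j, measurable_fun [set: R] (f j)) ->
  (forall j x, (0 <= f j x)%R) ->
  (forall j, \int[P]_x (f j (Y j x))%:E \is a fin_num) ->
  \int[P]_x (\prod_j f j (Y j x))%:E = \prod_j \int[P]_x (f j (Y j x))%:E.
Proof.
(* The functions [g j] are allowed to differ from indicators only for [j] in [s]. *)
move=> indY.
suff main (s : seq J) (g : J -> R -> R) :
    (forall j, measurable_fun [set: R] (g j)) ->
    (forall j x, (0 <= g j x)%R) ->
    (forall j, \int[P]_x (g j (Y j x))%:E \is a fin_num) ->
    (forall j, j \notin s -> exists2 B, measurable B & g j = \1_B) ->
  \int[P]_x (\prod_j g j (Y j x))%:E = \prod_j \int[P]_x (g j (Y j x))%:E.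
  by move=> mf f0 ff; apply: (main (enum J)) => // j; rewrite mem_enum.
elim: s g => [|k s IH] g mg g0 gfin gind.
  have {}gind j : exists B, measurable B /\ g j = \1_B.
    by have [//|B mB ->] := gind j; exists B.
  have [B /all_and2[mB gB]] := choice gind.
  have mYB j : measurable (Y j @^-1` B j) by exact: measurable_funPTI.
  transitivity (P (\bigcap_(j in [set` [set: J]%SET]) (Y j @^-1` B j))).
    rewrite -[X in _ = P X]setIT -integral_indic//; last first.
      by apply: fin_bigcap_measurable => //; exact: finite_finset.
    apply: eq_integral => x _; rewrite -prod_indic; congr EFin.
    by apply: eq_bigr => j _; rewrite gB.
  rewrite indY//; apply: eq_big => [j|j _]; first by rewrite inE.
  under eq_integral do rewrite gB.
  by rewrite (_ : (fun x => _) = EFin \o \1_(Y j @^-1` B j)) ?integral_indic ?setIT.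
have mY (j : J) : measurable_fun [set: N] (g j \o Y j) by exact: measurableT_comp.
pose h x := (\prod_(j | j != k) g j (Y j x))%R.
pose c := fine (\prod_(j | j != k) \int[P]_x (g j (Y j x))%:E).
have cE : c%:E = \prod_(j | j != k) \int[P]_x (g j (Y j x))%:E.
  by rewrite fineK// prode_fin_num.
under eq_integral do rewrite (bigD1 k)//= -/(h _).
rewrite (bigD1 k)//= -cE muleC.
apply: ge0_integral_indep_scale => //.
- rewrite /h; under eq_fun do rewrite -big_filter.
  by apply: measurable_prod => j _; exact: mY.
- by move=> x; apply: prodr_ge0.
- by rewrite fine_ge0//; apply: prode_ge0 => j _; apply: integral_ge0 => x _; rewrite lee_fin.
move=> B mB; have mYB : measurable (Y k @^-1` B) by exact: measurable_funPTI.
have PE : P (Y k @^-1` B) = \int[P]_x (\1_B (Y k x))%:E.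
  by rewrite -[X in P X]setIT -integral_indic.
(* With an indicator as [k]-th factor, [k] is no longer needed in the list, so the induction
   hypothesis applies. *)
pose g' j := if j == k then \1_B : R -> R else g j.
have g'E j : j != k -> g' j = g j by rewrite /g' => /negbTE ->.
have g'k : g' k = \1_B by rewrite /g' eqxx.
rewrite -[RHS](_ : \int[P]_x (\prod_j g' j (Y j x))%:E = _).
  rewrite integral_mkcond; apply: eq_integral => x _.
  rewrite patchE (bigD1 k)//= g'k indicE.
  rewrite (_ : (x \in _) = (Y k x \in B)); last by apply/idP/idP => /set_mem ?; apply/mem_set.
  case: ifPn => _; last by rewrite mul0r.
  by rewrite mul1r /h; congr EFin; apply: eq_bigr => j jk; rewrite g'E.
rewrite IH.
- rewrite (bigD1 k)//= cE PE muleC g'k; congr (_ * _).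
  by apply: eq_bigr => j jk; rewrite g'E.
- by move=> j; rewrite /g'; case: ifP.
- by move=> j x; rewrite /g'; case: ifP => // _; rewrite indicE.
- move=> j; have [->|jk] := eqVneq j k; last by rewrite g'E.
  by rewrite g'k -PE fin_num_measure.
- move=> j js; have [->|jk] := eqVneq j k; first by exists B.
  by rewrite g'E//; apply: gind; rewrite inE negb_or jk.
Qed.

End Independence.

(** * Change of measure for independent observations *)

Section ChangeOfMeasure.
Local Open Scope ereal_scope.
Context {R : realType} {dN : measure_display} {N : measurableType dN}.
Context {P : probability N R} {n : nat} {d : 'I_n -> nat}.
Variable Omega : {set mindex d}.
Local Notation J := {i : mindex d | i \in Omega}.
Local Notation obsType := (g_sigma_algebraType (@cylinders R n d Omega)).

Lemma measurable_observe (Y : J -> {RV P >-> R}) :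
  measurable_fun [set: N] (fun z => (fun j => Y j z) : obsType).
Proof.
apply: (@measurability _ _ N obsType setT _ (@cylinders R n d Omega)) => //.
move=> _ [_ [j [B [mB ->]]] <-]; rewrite setTI.
exact: measurable_funPTI.
Qed.

(** Unlike the cylinders, these sets are closed under intersection, and they generate the same
    sigma-algebra, as uniqueness of measures requires. *)
Definition boxes : set (set obsType) :=
  [set E | exists2 B : J -> set R, (forall j, measurable (B j)) &
    E = \bigcap_(j in [set` [set: J]%SET]) [set y : J -> R | B j (y j)]].

Lemma setI_closed_boxes : setI_closed boxes.
Proof.
move=> _ _ [A mA ->] [B mB ->]; exists (fun j => A j `&` B j).
  by move=> j; exact: measurableI.
by rewrite -bigcapI.
Qed.

Lemma boxesT : boxes setT.
Proof.
exists (fun=> setT) => //; apply/esym; rewrite -subTset => y _ j _ //.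
Qed.

Lemma measurable_boxes : boxes `<=` measurable.
Proof.
move=> _ [B mB ->]; apply: fin_bigcap_measurable; first exact: finite_finset.
by move=> j _; apply: sub_sigma_algebra; exists j, (B j).
Qed.

Lemma sigma_boxes (E : set obsType) : measurable E -> <<s boxes >> E.
Proof.
move=> mE; have /= := mE; apply: smallest_sub; first exact: smallest_sigma_algebra.
move=> _ [j [B [mB ->]]]; apply: sub_sigma_algebra.
exists (fun k => if k == j then B else setT).
  by move=> k; case: ifP.
apply/seteqP; split => [y By k _|y /(_ j)]/=.
  by case: eqP => [->|//].
by rewrite eqxx; apply; rewrite /= inE.
Qed.

Variables (Y Y' : J -> {RV P >-> R}) (L : J -> R -> R).
Hypotheses (indY : independent_RVs Y) (indY' : independent_RVs Y').
Hypotheses (mL : forall j, measurable_fun [set: R] (L j))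
  (L0 : forall j x, (0 <= L j x)%R).
Hypothesis Y'L : forall j (B : set R), measurable B ->
  P (Y' j @^-1` B) = \int[P]_(z in Y j @^-1` B) (L j (Y j z))%:E.

(** Both sides are finite measures of [E]. On boxes independence factors them, and [Y'L] matches the
    factors; boxes determine the measure. *)
Lemma change_of_law (E : set obsType) : measurable E ->
  P [set z | E (fun j => Y' j z)] =
  \int[P]_(z in [set z | E (fun j => Y j z)]) (\prod_j L j (Y j z))%:E.
Proof.
move=> mE.
have mLY j : measurable_fun [set: N] (L j \o Y j) by exact: measurableT_comp.
pose G z := (\prod_j L j (Y j z))%R.
have mG : measurable_fun [set: N] G by apply: measurable_prod => j _; exact: mLY.
have G0 z : (0 <= G z)%R by apply: prodr_ge0.
have mF := measurable_observe Y; have mF' := measurable_observe Y'.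
pose F : N -> obsType := fun z j => Y j z.
pose F' : N -> obsType := fun z j => Y' j z.
pose m1 : {measure set obsType -> \bar R} :=
  pushforward P F'.
pose m2 : {measure set obsType -> \bar R} :=
  pushforward (with_density P mG G0) F.
change (m1 mF' E = m2 mF E).
apply: (@g_sigma_algebra_measure_unique _ _ _ boxes measurable_boxes (fun=> setT)).
- by move=> _; exact: boxesT.
- by rewrite bigcup_const.
- exact: setI_closed_boxes.
- move=> _ [B mB ->]; have mYB j : measurable (Y j @^-1` B j) by exact: measurable_funPTI.
  pose f j x := (\1_(B j) x * L j x)%R.
  have fE j : \int[P]_z (f j (Y j z))%:E = P (Y' j @^-1` B j).
    rewrite Y'L// [RHS]integral_mkcond; apply: eq_integral => z _.
    rewrite patchE /f indicE.
    rewrite (_ : (z \in _) = (Y j z \in B j)).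
      by case: ifPn; rewrite ?mul1r ?mul0r.
    by apply/idP/idP => /set_mem ?; apply/mem_set.
  transitivity (\int[P]_z (\prod_j f j (Y j z))%:E).
    rewrite integral_prod_indep//.
    - rewrite (eq_bigr _ (fun j _ => fE j)).
      transitivity (\prod_(j in [set: J]%SET) P (Y' j @^-1` B j)).
        by rewrite -indY'.
      by apply: eq_bigl => j; rewrite inE.
    - by move=> j; apply: measurable_funM => //; exact: measurable_indic.
    - by move=> j x; rewrite mulr_ge0.
    - by move=> j; rewrite fE fin_num_measure//; exact: measurable_funPTI.
  rewrite [RHS]integral_mkcond; apply: eq_integral => z _.
  rewrite /f big_split/= patchE (prod_indic (fun j => Y j @^-1` B j) z) indicE.
  by case: ifPn; rewrite ?mul1r ?mul0r.
- by rewrite /m1 /= /pushforward preimage_setT probability_setT ltry.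
- exact: sigma_boxes.
Qed.

(* The likelihood ratio [G] is split with [G <= lam + G^2 / (4 * lam)], which keeps
   the bound linear in the probability of [E]. *)
Lemma le_change_of_measure (lam : R) (E : set obsType) :
  (0 < lam)%R -> measurable E ->
  (forall j, \int[P]_z (L j (Y j z) ^+ 2)%:E \is a fin_num) ->
  P [set z | E (fun j => Y' j z)] <=
  lam%:E * P [set z | E (fun j => Y j z)] +
  (4 * lam)^-1%:E * \prod_j \int[P]_z (L j (Y j z) ^+ 2)%:E.
Proof.
move=> lam0 mE L2fin; rewrite change_of_law//.
have mLY j : measurable_fun [set: N] (L j \o Y j) by exact: measurableT_comp.
pose G z := (\prod_j L j (Y j z))%R.
have mG : measurable_fun [set: N] G by apply: measurable_prod => j _; exact: mLY.
have mG2 : measurable_fun [set: N] (fun z => (G z ^+ 2)%:E).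
  exact/measurable_EFinP/measurable_funX.
have mD : measurable [set z | E (fun j => Y j z)].
  by rewrite -[X in measurable X]setTI; exact: measurable_observe.
set D := [set z | _].
rewrite -(integral_prod_indep (f := fun j x => (L j x ^+ 2)%R))//; last 2 first.
- by move=> j; exact: measurable_funX.
- by move=> j x; exact: sqr_ge0.
under [X in _ <= _ + _ * X]eq_integral do rewrite prodrXl -/(G _).
apply: (@le_trans _ _ (\int[P]_(z in D) (lam%:E + (4 * lam)^-1%:E * (G z ^+ 2)%:E))).
  apply: ge0_le_integral => //.
  - by move=> z _; rewrite lee_fin; apply: prodr_ge0.
  - by apply/measurable_EFinP/measurable_funTS.
  - apply: emeasurable_funD => //; apply: measurable_funeM.
    exact: measurable_funTS.
  - move=> z _; rewrite -EFinM -EFinD lee_fin -/(G z).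
    rewrite -lerBlDl [leRHS]mulrC ler_pdivlMr; last by rewrite mulr_gt0.
    rewrite -subr_ge0 (_ : _ - _ = (G z - 2 * lam) ^+ 2)%R ?sqr_ge0//.
    ring.
rewrite ge0_integralD//=; last 3 first.
- by move=> z _; rewrite lee_fin ltW.
- by move=> z _; rewrite -EFinM lee_fin mulr_ge0 ?sqr_ge0// invr_ge0 mulr_ge0// ltW.
- by apply: measurable_funeM; exact: measurable_funTS.
rewrite integral_cst// leeD2l//.
rewrite ge0_integralZl//=; last 3 first.
- exact: measurable_funTS.
- by move=> z _; rewrite lee_fin sqr_ge0.
- by rewrite lee_fin invr_ge0 mulr_ge0// ltW.
rewrite lee_wpmul2l//; first by rewrite lee_fin invr_ge0 mulr_ge0// ltW.
by apply: ge0_subset_integral => // z _; rewrite lee_fin sqr_ge0.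
Qed.

End ChangeOfMeasure.

(** * Normal distributions *)

Section Normal.
Local Open Scope ereal_scope.
Context {R : realType}.
Local Notation mu := (@lebesgue_measure R).

Let addr_ (t : R) (x : measurableTypeR R) : measurableTypeR R := (x + t)%R.

Let measurable_addr t : measurable_fun [set: measurableTypeR R] (addr_ t).
Proof. exact: measurable_funD. Qed.

Lemma lebesgue_measure_addr (t : R) (A : set R) : measurable A ->
  pushforward mu (addr_ t) A = mu A.
Proof.
move=> mA; apply/esym/lebesgue_measure_unique => // _ [[a b]] _ <-.
rewrite /= /pushforward.
rewrite (_ : _ @^-1` _ = `](a - t)%R, (b - t)%R]%classic); last first.
  by apply/seteqP; split => x /=; rewrite /addr_ !in_itv/= ltrBlDr lerBrDr.
rewrite !lebesgue_measure_itv/= !lte_fin ltrD2r; case: ifPn => // _.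
by rewrite -!EFinB; congr EFin; ring.
Qed.

Lemma normal_pdf_addr (t s x : R) : s != 0%R ->
  normal_pdf t s (x + t) = normal_pdf 0 s x.
Proof. by move=> s0; rewrite !normal_pdfE// /normal_fun addrK subr0. Qed.

Lemma normal_prob_addr (t s : R) (B : set R) : s != 0%R -> measurable B ->
  normal_prob 0%R s [set x | B (x + t)%R] = normal_prob t s B.
Proof.
move=> s0 mB; rewrite /normal_prob.
have mpdf : measurable_fun [set: R] (EFin \o normal_pdf t s).
  by apply/measurable_EFinP; exact: measurable_normal_pdf.
transitivity (\int[pushforward mu (addr_ t)]_(x in B) (normal_pdf t s x)%:E).
  rewrite (ge0_integral_pushforward (measurable_addr t))//=.
  - by apply: eq_integral => x _; rewrite normal_pdf_addr.
  - exact: measurable_funTS.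
  - by move=> y _; rewrite lee_fin normal_pdf_ge0.
by apply: eq_measure_integral => A mA _; exact: lebesgue_measure_addr.
Qed.

Context {dN : measure_display} {N : measurableType dN} {P : probability N R}.

Lemma integral_normal_RV (Y : {RV P >-> R}) (t s : R) (f : R -> R) :
  (forall B : set R, measurable B -> distribution P Y B = normal_prob t s B) ->
  measurable_fun [set: R] f -> (forall x, (0 <= f x)%R) ->
  \int[P]_z (f (Y z))%:E = \int[mu]_x (f x * normal_pdf t s x)%:E.
Proof.
move=> YN mf f0.
have mEf : measurable_fun [set: measurableTypeR R] (EFin \o f : measurableTypeR R -> \bar R).
  exact/measurable_EFinP.
have Ef0 x : 0 <= (EFin \o f) x by rewrite lee_fin.
have mY : measurable_fun [set: N] (Y : N -> measurableTypeR R).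
  exact: (measurable_funP Y).
transitivity (\int[pushforward P (Y : N -> measurableTypeR R)]_x (EFin \o f) x).
  by rewrite (ge0_integral_pushforward mY).
pose pdf : measurableTypeR R -> R := normal_pdf t s.
have mpdf : measurable_fun [set: measurableTypeR R] pdf by exact: measurable_normal_pdf.
have pdf0 x : (0 <= pdf x)%R by exact: normal_pdf_ge0.
transitivity (\int[with_density mu mpdf pdf0]_x (f x)%:E).
  by apply: eq_measure_integral => A mA _; exact: YN.
by rewrite (@ge0_integral_with_density _ _ _ mu pdf mpdf pdf0 (EFin \o f)).
Qed.

(** The likelihood ratio of the normal law of mean [t'] against that of mean [t]; the normalizing
    constants cancel. *)
Definition normal_ratio (t t' s x : R) : R :=
  expR (((x - t) ^+ 2 - (x - t') ^+ 2) / (s ^+ 2 *+ 2)).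

Lemma measurable_normal_ratio t t' s : measurable_fun [set: R] (normal_ratio t t' s).
Proof.
apply: measurableT_comp => //; apply: measurable_funM => //.
by apply: measurable_funB; apply: measurable_funX; exact: measurable_funB.
Qed.

Lemma normal_ratioE (t t' s x : R) : s != 0%R ->
  (normal_ratio t t' s x * normal_pdf t s x)%R = normal_pdf t' s x.
Proof.
move=> s0; rewrite !normal_pdfE// /normal_ratio /normal_fun mulrCA -expRD.
by congr (_ * expR _)%R; field.
Qed.

(** Completing the square: the squared ratio moves the mean from [t] to [2 * t' - t], up to a
    constant factor, which is therefore the second moment of the ratio. *)
Lemma normal_ratio_sqrE (t t' s x : R) : s != 0%R ->
  (normal_ratio t t' s x ^+ 2 * normal_pdf t s x)%R =
  (expR ((t' - t) ^+ 2 / s ^+ 2) * normal_pdf (2 * t' - t) s x)%R.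
Proof.
move=> s0; rewrite !normal_pdfE// /normal_ratio /normal_fun mulrCA [RHS]mulrCA.
by rewrite -expRM_natl -!expRD; congr (_ * expR _)%R; field.
Qed.

Lemma normal_ratio_density (Y : {RV P >-> R}) (t t' s : R) (B : set R) :
  s != 0%R ->
  (forall B : set R, measurable B -> distribution P Y B = normal_prob t s B) ->
  measurable B ->
  normal_prob t' s B = \int[P]_(z in Y @^-1` B) (normal_ratio t t' s (Y z))%:E.
Proof.
move=> s0 YN mB.
transitivity (\int[P]_z (\1_B (Y z) * normal_ratio t t' s (Y z))%:E); last first.
  rewrite [RHS]integral_mkcond; apply: eq_integral => z _.
  rewrite patchE indicE (_ : (z \in _) = (Y z \in B)).
    by case: ifPn; rewrite ?mul1r ?mul0r.
  by apply/idP/idP => /set_mem ?; apply/mem_set.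
rewrite (@integral_normal_RV Y t s (fun x => \1_B x * normal_ratio t t' s x)%R)//.
- rewrite /normal_prob integral_mkcond; apply: eq_integral => x _.
  rewrite patchE -mulrA normal_ratioE// indicE.
  by case: ifPn; rewrite ?mul1r ?mul0r.
- by apply: measurable_funM; [exact: measurable_indic|exact: measurable_normal_ratio].
- by move=> x; rewrite mulr_ge0// expR_ge0.
Qed.

Lemma integral_normal_ratio_sqr (Y : {RV P >-> R}) (t t' s : R) :
  s != 0%R ->
  (forall B : set R, measurable B -> distribution P Y B = normal_prob t s B) ->
  \int[P]_z (normal_ratio t t' s (Y z) ^+ 2)%:E = (expR ((t' - t) ^+ 2 / s ^+ 2))%:E.
Proof.
move=> s0 YN.
rewrite (@integral_normal_RV Y t s (fun x => normal_ratio t t' s x ^+ 2)%R)//.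
- under eq_integral do rewrite normal_ratio_sqrE// EFinM.
  rewrite ge0_integralZl//.
  + by rewrite integral_normal_pdf mule1.
  + by apply/measurable_EFinP; exact: measurable_normal_pdf.
  + by move=> x _ /=; rewrite lee_fin normal_pdf_ge0.
- by apply: measurable_funX; exact: measurable_normal_ratio.
- by move=> x; exact: sqr_ge0.
Qed.

End Normal.

(** * Gaussian noise *)

Section GaussianNoise.
Local Open Scope ereal_scope.
Context {R : realType} {n : nat} {d : 'I_n -> nat} {Omega : {set mindex d}}.
Context {dN : measure_display} {N : measurableType dN} {PN : probability N R}.
Variables (sigma : R) (Z : mindex d -> {RV PN >-> R}).
Hypotheses (sigma0 : (0 < sigma)%R) (ZN : iid_gaussian sigma Z).
Local Notation J := {i : mindex d | i \in Omega}.
Local Notation obsType := (g_sigma_algebraType (@cylinders R n d Omega)).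

Let measurable_addl (X : {RV PN >-> R}) (t : R) :
  measurable_fun [set: N] (fun z => t + X z)%R.
Proof. exact: measurable_funD. Qed.

Definition addRV (t : R) (X : {RV PN >-> R}) : {RV PN >-> R} :=
  HB.pack (fun z => t + X z)%R
    (isMeasurableFun.Build _ _ N R (fun z => t + X z)%R (measurable_addl X t)).

Let measurable_addl_preimage (t : R) (B : set R) : measurable B ->
  measurable [set x | B (t + x)%R].
Proof.
move=> mB; rewrite -[X in measurable X]setTI.
by have : measurable_fun [set: R] (fun x : R => t + x)%R; [exact: measurable_funD|apply].
Qed.

Lemma independent_addRV (T : tensor R d) :
  independent_RVs (fun j : J => addRV (T (val j)) (Z (val j))).
Proof.
move=> K B mB.
(* Independence of [Z] is over all multi-indices: each [B j] is pulled back through its translation,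
   and [setT] is a filler outside [Omega]. *)
pose B' i : set R := if insub i is Some j then [set x | B j (T i + x)%R] else setT.
have B'E (j : J) : B' (val j) = [set x | B j (T (val j) + x)%R] by rewrite /B' valK.
have mB' i : measurable (B' i).
  by rewrite /B'; case: insubP => [j _ _|_] //; exact: measurable_addl_preimage.
have [/(_ (val @: K)%SET B' mB') + _] := ZN.
rewrite big_imset/=; last by move=> ? ? _ _; exact: val_inj.
under eq_bigr do rewrite B'E.
rewrite (_ : \bigcap_(_ in _) _ =
  \bigcap_(j in [set` K]) (addRV (T (val j)) (Z (val j)) @^-1` B j)) => [->//|].
apply/seteqP; split => z H j /= jK.
  by have := H (val j); rewrite /= B'E; apply; exact: imset_f.
by case/imsetP: jK => k kK ->; rewrite B'E; exact: H.
Qed.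

Lemma distribution_addRV (t : R) i (B : set R) : measurable B ->
  distribution PN (addRV t (Z i)) B = normal_prob t sigma B.
Proof.
move=> mB; rewrite -normal_prob_addr ?gt_eqF//.
rewrite (_ : [set _ | _] = [set x | B (t + x)%R]).
  by rewrite -(proj2 ZN i)//; exact: measurable_addl_preimage.
by apply/seteqP; split => x /=; rewrite addrC.
Qed.

(** The second moments of the independent likelihood ratios multiply, so the two signals enter only
    through their squared distance on [Omega], in units of [sigma]. *)
Lemma gaussian_change_of_measure (T T' : tensor R d) (lam : R) (E : set obsType) :
  (0 < lam)%R -> measurable E ->
  PN [set z | E (restr Omega T' \+ restr Omega (Z ^~ z))%R] <=
  lam%:E * PN [set z | E (restr Omega T \+ restr Omega (Z ^~ z))%R] +
  ((4 * lam)^-1 * expR (\sum_(i in Omega) ((T' i - T i) / sigma) ^+ 2))%:E.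
Proof.
move=> lam0 mE; have s0 : sigma != 0%R by rewrite gt_eqF.
have L2 (j : J) : \int[PN]_z ((normal_ratio (T (val j)) (T' (val j)) sigma
    (addRV (T (val j)) (Z (val j)) z)) ^+ 2)%:E =
    (expR (((T' (val j) - T (val j)) / sigma) ^+ 2))%:E.
  rewrite (integral_normal_ratio_sqr _ s0 (distribution_addRV _ _)).
  by rewrite expr_div_n.
have := @le_change_of_measure R dN N PN n d Omega
  (fun j => addRV (T (val j)) (Z (val j))) (fun j => addRV (T' (val j)) (Z (val j)))
  (fun j => normal_ratio (T (val j)) (T' (val j)) sigma)
  (@independent_addRV T) (@independent_addRV T') (fun j => @measurable_normal_ratio _ _ _ _)
  (fun j x => expR_ge0 _).
move=> /(_ _ lam E lam0 mE).
under [X in _ -> _ -> _ <= _ + _ * X]eq_bigr do rewrite L2.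
rewrite prodEFin -expR_sum -EFinM (big_sub Omega) => H; apply: H.
- move=> j B mB; rewrite -normal_ratio_density//.
  + exact: distribution_addRV.
  + exact: distribution_addRV.
- by move=> j; rewrite L2.
Qed.

Context {dS : measure_display} {S : measurableType dS} (PS : probability S R).

Definition observed (T : tensor R d) (x : S * N) : S * obsType :=
  (x.1, restr Omega T \+ restr Omega (Z ^~ x.2))%R.

Lemma measurable_observed T : measurable_fun [set: S * N] (observed T).
Proof.
apply: measurable_fun_pair; first exact: measurable_fst.
have := measurable_observe (fun j : J => addRV (T (val j)) (Z (val j))).
by move=> /measurableT_comp/(_ _); apply; exact: measurable_snd.
Qed.

(** For a fixed seed this is the Gaussian bound on the section of [E]; integration over the seed
    preserves the constant term because [PS] has mass 1. *)
Lemma seeded_change_of_measure (T T' : tensor R d) (lam : R) (E : set (S * obsType)) :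
  (0 < lam)%R -> measurable E ->
  (PS \x PN) (observed T' @^-1` E) <= lam%:E * (PS \x PN) (observed T @^-1` E) +
  ((4 * lam)^-1 * expR (\sum_(i in Omega) ((T' i - T i) / sigma) ^+ 2))%:E.
Proof.
move=> lam0 mE; set K := (_ * expR _)%R.
have mF T0 : measurable (observed T0 @^-1` E).
  by rewrite -[X in measurable X]setTI; exact: measurable_observed.
have K0 : (0 <= K)%R by rewrite mulr_ge0 ?expR_ge0// invr_ge0 mulr_ge0// ltW.
have mx T0 : measurable_fun [set: S] (PN \o xsection (observed T0 @^-1` E)).
  exact: measurable_fun_xsection.
rewrite /product_measure1.
have -> : K%:E = \int[PS]_x K%:E.
  by rewrite integral_cst// [X in _ * X]probability_setT mule1.
rewrite -ge0_integralZl//; last by rewrite lee_fin ltW.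
have mlx T0 : measurable_fun [set: S] (fun x => lam%:E * (PN \o xsection (observed T0 @^-1` E)) x).
  exact: measurable_funeM.
have lx0 T0 x : 0 <= lam%:E * (PN \o xsection (observed T0 @^-1` E)) x.
  by rewrite mule_ge0// lee_fin ltW.
rewrite -ge0_integralD//=.
apply: ge0_le_integral => //=.
- exact: mx.
- by apply: emeasurable_funD => //; exact: mlx.
- move=> x _.
  have xE T0 : xsection (observed T0 @^-1` E) x =
      [set z | xsection E x (restr Omega T0 \+ restr Omega (Z ^~ z))%R].
    by apply/seteqP; split => z; rewrite /xsection /= !inE.
  rewrite !xE; apply: gaussian_change_of_measure => //.
  exact: measurable_xsection.
- by move=> x _; exact: lx0.
- exact: mlx.
Qed.

End GaussianNoise.

(** * Balanced blocks *)

Section Combinatorics.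
Context {R : realType}.

(** The sum is the expansion over subsets of [\prod_i (W i + (1 - W i))], whose factors are 1. *)
Lemma sampling_prob_setT (n : nat) (d : 'I_n -> nat) (W : tensor R d) :
  sampling_prob W setT = 1.
Proof.
rewrite /sampling_prob; under eq_bigl do rewrite asboolT//.
have := @bigA_distr R 0 1 *%R +%R _ W (fun i => 1 - W i).
rewrite [X in X = _ -> _]big1 => [distr1|i _]; last by rewrite /= addrCA subrr addr0.
rewrite [RHS]distr1.
apply: eq_bigr => Om _; rewrite [RHS](bigID (mem Om))/=; congr (_ * _).
  by apply: eq_bigr => i ->.
by apply: eq_big => [i|i]; [rewrite !inE|rewrite !inE => /negbTE ->].
Qed.

(** Each new element joins a class whose load is at most the average, so that class ends at most [M]
    above it; the other loads stay while the average can only grow. *)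
Lemma greedy_partition (I : finType) (r : nat) (w : I -> R) (M : R) (s : seq I) :
  (0 < r)%N -> 0 <= M -> (forall i, 0 <= w i <= M) -> uniq s ->
  exists f : I -> 'I_r, forall b,
    \sum_(i <- s | f i == b) w i <= (\sum_(i <- s) w i) / r%:R + M.
Proof.
case: r => // r _ M0 wM; elim: s => [_|i s IH /= /andP[iNs us]].
  by exists (fun=> ord0) => b; rewrite !big_nil mul0r add0r.
have [f fP] := IH us.
have [b0 b0P] : exists b, \sum_(j <- s | f j == b) w j <= (\sum_(j <- s) w j) / r.+1%:R.
  apply: contrapT => /forallNP lt_load.
  have : \sum_(b < r.+1) ((\sum_(j <- s) w j) / r.+1%:R) <
         \sum_(b < r.+1) \sum_(j <- s | f j == b) w j.
    apply: ltr_sum => [|b _]; last by rewrite ltNge; apply/negP/lt_load.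
    by apply/hasP; exists ord0 => //; rewrite mem_index_enum.
  rewrite [X in _ < X](_ : _ = \sum_(j <- s) w j); last first.
    by rewrite [RHS](partition_big f xpredT).
  by rewrite sumr_const card_ord -[X in X < _]mulr_natr divfK ?pnatr_eq0// ltxx.
exists (fun j => if j == i then b0 else f j) => b.
rewrite !big_cons eqxx.
have -> : \sum_(j <- s | (if j == i then b0 else f j) == b) w j =
          \sum_(j <- s | f j == b) w j.
  rewrite big_seq_cond [RHS]big_seq_cond; apply: eq_bigl => j.
  by case: (eqVneq j i) => [->|//]; rewrite (negbTE iNs).
have /andP[wi0 wiM] := wM i.
case: (eqVneq b0 b) => [<-|_].
  rewrite addrC lerD// (le_trans b0P)// ler_wpM2r ?invr_ge0//.
  by rewrite lerDr.
by rewrite (le_trans (fP b))// lerD2r ler_wpM2r ?invr_ge0// lerDr.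
Qed.

Lemma sum_prod_mindex (n : nat) (d : 'I_n -> nat) (F : forall k, 'I_(d k) -> R) :
  \sum_(i : mindex d) \prod_k F k (i k) = \prod_k \sum_a F k a.
Proof.
rewrite (reindex (@dffun_of_fprod _ (fun k => 'I_(d k)))); last first.
  by exists (@fprod_of_dffun _ _) => i _; [exact: dffun_of_fprodK|exact: fprod_of_dffunK].
pose G k := [ffun a : 'I_(d k) => F k a].
transitivity (\sum_(t : fprod (fun k => 'I_(d k))) \prod_k G k (t k)).
  by apply: eq_bigr => t _; apply: eq_bigr => k _; rewrite !ffunE.
rewrite (big_fprod 1 +%R G).
rewrite -(bigA_distr_big_dep (fun k => tagged_with (fun k => 'I_(d k)) k)
  (fun k u => untag 0 (G k) u)).
apply: eq_bigr => k _; rewrite -(big_tag (fun k => G k)).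
by apply: eq_bigr => a _; rewrite ffunE.
Qed.

End Combinatorics.

Section Blocks.
Context {R : realType} {n : nat} {d r : 'I_n -> nat}.

Definition block (f : forall k, 'I_(d k) -> 'I_(r k)) (i : mindex d) : mindex r :=
  [ffun k => f k (i k)].

Lemma block_insert f (k : 'I_n) (a a' : 'I_(d k)) (c : coindex d k) :
  f k a = f k a' -> block f (insert a c) = block f (insert a' c).
Proof.
move=> faa'; apply/ffunP => j; rewrite !ffunE; case: unliftP => // e.
move: a a' faa' {c}; case: k / e => a a' faa'.
by rewrite !cast_ord_id.
Qed.

(** Row [a] of the unfolding depends only on the class of [a], so the unfolding factors through a
    space of dimension [r k]. *)
Lemma tucker_cone_block (T : tensor R d) f (g : mindex r -> R) :
  (forall i, T i = g (block f i)) -> tucker_cone r T.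
Proof.
move=> Tg k.
pose S : 'M[R]_(d k, r k) := \matrix_(a, b) (f k a == b)%:R.
(* Row [b] is copied from a representative of the class; an empty class gets zeros, and no row of
   [S] selects it. *)
pose M : 'M[R]_(r k, _) := \matrix_(b, c)
  if [pick a | f k a == b] is Some a then unfolding k T a c else 0.
suff -> : unfolding k T = S *m M.
  exact: leq_trans (mxrankM_maxl _ _) (rank_leq_col _).
apply/matrixP => a c; rewrite mxE [RHS]mxE (bigD1 (f k a))//= !mxE eqxx mul1r.
rewrite big1 ?addr0 => [|b bk]; last by rewrite mxE eq_sym (negbTE bk) mul0r.
case: pickP => [a' /eqP fa'|/(_ a)]; last by rewrite eqxx.
by rewrite mxE !Tg (block_insert _ fa').
Qed.

Lemma le_max_abs p (v : 'I_p -> R) i : `|v i| <= max_abs v.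
Proof. exact: le_bigmax. Qed.

Lemma ge_min_abs p (v : 'I_p -> R) i : min_abs v <= `|v i|.
Proof. exact: bigmin_le. Qed.

(** Each mode is cut by [greedy_partition]. Its overshoot [max_abs (w k)] is at most [C'] times the
    mean of the [|w k a|], that is [C' * r k / d k] times the average class load. The bounds
    multiply over the modes because the tensor is an outer product. *)
Lemma balanced_blocks (C' : R) (w : forall k, 'I_(d k) -> R) (i0 : mindex d) :
  0 < C' -> (forall i, 0 < outer w i) ->
  (forall k, max_abs (w k) <= C' * min_abs (w k)) -> (forall k, 0 < r k)%N ->
  exists f, forall b,
    \sum_(i | block f i == b) outer w i <=
    \prod_k (1 + 2 * C' ^+ 2 * ((r k)%:R / (d k)%:R)) * (\sum_i outer w i)
      / \prod_k (r k)%:R.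
Proof.
move=> C'0 W0 wC r0.
(* Only the products are known to be positive: a single [w k] may have negative entries, so masses
   are taken in absolute value. *)
have abs_outer i : outer w i = \prod_k `|w k (i k)|.
  by rewrite -normr_prod gtr0_norm ?W0.
have d0 k : (0 < d k)%N by exact: leq_ltn_trans (ltn_ord (i0 k)).
have mx0 k : 0 < max_abs (w k).
  apply: lt_le_trans (le_max_abs _ (i0 k)); rewrite normr_gt0.
  have := W0 i0; rewrite /outer (bigD1 k)//= => /gt_eqF/negbT.
  by rewrite mulf_eq0 negb_or => /andP[].
(* An entry of mode [k] lies between [min_abs] and [max_abs], which forces [1 <= C']; this allows
   [C'] to be relaxed to [2 * C' ^+ 2]. *)
have C'1 (k : 'I_n) : 1 <= C'.
  rewrite -(ler_pM2r (mx0 k)) mul1r (le_trans (wC k))// ler_wpM2l ?(ltW C'0)//.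
  exact: le_trans (ge_min_abs _ (i0 k)) (le_max_abs _ _).
have fP (k : 'I_n) : exists f : 'I_(d k) -> 'I_(r k), forall b,
    \sum_(a | f a == b) `|w k a| <=
    (1 + 2 * C' ^+ 2 * ((r k)%:R / (d k)%:R)) * (\sum_a `|w k a|) / (r k)%:R.
  have wM a : 0 <= `|w k a| <= max_abs (w k) by rewrite normr_ge0 le_max_abs.
  have [f fb] := greedy_partition (r0 k) (ltW (mx0 k)) wM (index_enum_uniq _).
  exists f => b; apply: (le_trans (fb b)).
  have S0 : 0 <= \sum_a `|w k a| by apply: sumr_ge0.
  have mxS : max_abs (w k) <= C' * ((\sum_a `|w k a|) / (d k)%:R).
    apply: (le_trans (wC k)); rewrite ler_wpM2l ?(ltW C'0)//.
    rewrite ler_pdivlMr ?ltr0n// mulr_natr -[X in _ *+ X]card_ord -sumr_const.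
    by apply: ler_sum => a _; exact: ge_min_abs.
  rewrite [leRHS](_ : _ = (\sum_a `|w k a|) / (r k)%:R +
      (2 * C' ^+ 2) * ((\sum_a `|w k a|) / (d k)%:R)); last first.
    by field; rewrite !pnatr_eq0 -!lt0n r0 d0.
  rewrite lerD2l (le_trans mxS)// ler_wpM2r ?divr_ge0//.
  rewrite expr2 mulrCA ler_peMr ?(ltW C'0)//.
  by rewrite (le_trans (C'1 k))// ler_peMl ?(ltW C'0)// ler1n.
pose f k := projT1 (cid (fP k)); exists f => b.
have fb k := projT2 (cid (fP k)) (b k); rewrite -/(f _) in fb.
rewrite (eq_bigr _ (fun i _ => abs_outer i)) [X in _ * X / _](eq_bigr _ (fun i _ => abs_outer i)).
rewrite big_mkcond/= (sum_prod_mindex (fun k a => `|w k a|)) -prodfV -!big_split/=.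
have -> : \sum_(i : mindex d) (if block f i == b then \prod_k `|w k (i k)| else 0) =
    \prod_k \sum_a (if f k a == b k then `|w k a| else 0).
  rewrite -(sum_prod_mindex (fun k a => if f k a == b k then `|w k a| else 0)).
  apply: eq_bigr => i _; case: eqP => [<-|fib].
    by apply: eq_bigr => k _; rewrite ffunE eqxx.
  have [k fk] : exists k, f k (i k) != b k.
    apply: contrapT => /forallNP H; apply: fib; apply/ffunP => k.
    by rewrite ffunE; have /negP/negPn/eqP := H k.
  by rewrite (bigD1 k)//= (negbTE fk) mul0r.
apply: ler_prod => k _; rewrite -big_mkcond/= fb andbT.
by apply: sumr_ge0.
Qed.

End Blocks.

(** For a heavy block, one with [sigma ^+ 2 < N b * tau ^+ 2], [sigma ^+ 2] times its mass is at
    most [N b * tau ^+ 2 * V]. The counts sum to [#|Om|], so the hypothesis keeps the heavy mass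
    below or at half of the total. *)
Lemma light_blocks (R : realType) (I B : finType) (bl : I -> B) (W : I -> R)
    (Om : {set I}) (V sigma tau : R) (N := fun b => \sum_(i in Om | bl i == b) (1 : R)) :
  0 < sigma -> 0 <= V -> (forall b, \sum_(i | bl i == b) W i <= V) ->
  2 * (#|Om|%:R * tau ^+ 2) * V <= sigma ^+ 2 * \sum_i W i ->
  (\sum_i W i) / 2 <= \sum_(i | N (bl i) * tau ^+ 2 <= sigma ^+ 2) W i.
Proof.
move=> s0 V0 WV hV; pose light b := N b * tau ^+ 2 <= sigma ^+ 2.
rewrite -/(light _) [X in X / 2](bigID (light \o bl))/=.
set mG := \sum_(i | light (bl i)) W i; set mB := \sum_(i | _) W i.
have sumN : \sum_b N b = #|Om|%:R.
  by rewrite -sumr_const [RHS](partition_big bl xpredT).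
have N0 b : 0 <= N b by apply: sumr_ge0.
have s20 : 0 < sigma ^+ 2 by rewrite exprn_gt0.
have mBV : sigma ^+ 2 * mB <= (#|Om|%:R * tau ^+ 2) * V.
  rewrite /mB (partition_big bl (fun b => ~~ light b))//= mulr_sumr.
  rewrite -sumN mulr_suml mulr_suml.
  apply: (@le_trans _ _ (\sum_(b | ~~ light b) N b * tau ^+ 2 * V)).
    apply: ler_sum => b bB; apply: (@le_trans _ _ (sigma ^+ 2 * V)).
      rewrite ler_pM2l//; apply: le_trans (WV b); rewrite le_eqVlt; apply/orP; left.
      by apply/eqP/eq_bigl => i; case: eqP => [->|]; rewrite ?bB ?andbF.
    by rewrite ler_wpM2r// ltW// ltNge.
  rewrite [leRHS](bigID light)/= lerDr sumr_ge0// => b _.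
  by rewrite mulr_ge0// mulr_ge0 ?sqr_ge0 ?N0.
have : sigma ^+ 2 * (2 * mB) <= sigma ^+ 2 * (mG + mB).
  apply: le_trans _ (le_trans hV _).
    by rewrite mulrCA -mulrA ler_pM2l.
  by rewrite ler_pM2l// (bigID (light \o bl))/=.
rewrite ler_pM2l//; lra.
Qed.

(** * Disjoint events and Markov's inequality under total mass 1 *)

Section FiniteProbability.
Local Open Scope ereal_scope.
Context d (T : measurableType d) (R : realType) (Q : {measure set T -> \bar R}).
Hypothesis Q1 : Q [set: T] = 1.

Lemma prob_le1 (E : set T) : measurable E -> Q E <= 1.
Proof. by move=> mE; rewrite -Q1 le_measure ?inE. Qed.

Lemma prob_fin_num (E : set T) : measurable E -> Q E \is a fin_num.
Proof. by move=> mE; rewrite ge0_fin_numE// (le_lt_trans (prob_le1 mE))// ltry. Qed.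

Lemma sum_prob_disjoint k (E : 'I_k -> set T) : (forall a, measurable (E a)) ->
  (forall a b, E a `&` E b !=set0 -> a = b) -> \sum_a Q (E a) <= 1.
Proof.
move=> mE dE; rewrite -measure_bigsetU_ord//; last first.
  by move=> a b _ _; exact: dE.
by apply: prob_le1; apply: bigsetU_measurable.
Qed.

Lemma measurable_mass (I : finType) (G : pred I) (W : I -> R) (E : I -> set T) :
  (forall i, measurable (E i)) ->
  measurable_fun [set: T] (fun x => \sum_(i | G i) W i * \1_(E i) x)%R.
Proof.
move=> mE; under eq_fun do rewrite -big_filter.
by apply: measurable_sum => i; apply: measurable_funM => //; exact: measurable_indic.
Qed.

(** Markov's inequality: the random mass has mean at most a quarter of the total, so it exceeds half
    of the total with probability at most 1/2. *)
Lemma prob_mass_ge_half (I : finType) (G : pred I) (W : I -> R) (E : I -> set T) :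
  (forall i, (0 <= W i)%R) -> (forall i, measurable (E i)) ->
  (0 < \sum_(i | G i) W i)%R ->
  (\sum_(i | G i) W i * fine (Q (E i)) <= (\sum_(i | G i) W i) / 4)%R ->
  (1 / 2)%:E <= Q [set x | (\sum_(i | G i) W i * \1_(E i) x <= (\sum_(i | G i) W i) / 2)%R].
Proof.
move=> W0 mE; set m := (\sum_(i | G i) W i)%R => m0 hm.
pose S x := (\sum_(i | G i) W i * \1_(E i) x)%R.
have mS : measurable_fun [set: T] S by exact: measurable_mass.
have S0 x : (0 <= S x)%R by apply: sumr_ge0 => i _; rewrite mulr_ge0// indicE.
pose D := [set x | (S x <= m / 2)%R].
have mD : measurable D.
  rewrite (_ : D = S @^-1` `]-oo, (m / 2)%R]); last first.
    by apply/seteqP; split => x /=; rewrite in_itv.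
  by rewrite -[X in measurable X]setTI; exact: mS.
have mDC := measurableC mD.
have intS : \int[Q]_x (S x)%:E = (\sum_(i | G i) W i * fine (Q (E i)))%:E.
  rewrite -sumEFin /S; under eq_integral do rewrite -sumEFin -big_filter.
  rewrite ge0_integral_sum//=.
  - rewrite big_filter; apply: eq_bigr => i _; under eq_integral do rewrite EFinM.
    rewrite ge0_integralZl ?lee_fin//.
    + by rewrite integral_indic// setIT EFinM fineK// prob_fin_num.
    + exact/measurable_EFinP/measurable_indic.
  - by move=> i; apply/measurable_EFinP/measurable_funM => //; exact: measurable_indic.
  - by move=> i x _; rewrite lee_fin mulr_ge0// indicE.
have QDC : (m / 2)%:E * Q (~` D) <= (m / 4)%:E.
  apply: (@le_trans _ _ (\int[Q]_x (S x)%:E)); last by rewrite intS lee_fin.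
  rewrite -integral_cst//.
  apply: (@le_trans _ _ (\int[Q]_(x in ~` D) (S x)%:E)).
    apply: ge0_le_integral => //.
    - by move=> x _; rewrite lee_fin ltW// divr_gt0.
    - exact/measurable_EFinP/measurable_funTS.
    - by move=> x /= /negP; rewrite -ltNge lee_fin => /ltW.
  apply: ge0_subset_integral => //.
  - exact/measurable_EFinP.
  - by move=> x _; rewrite lee_fin.
have QD : Q D + Q (~` D) = 1.
  by rewrite -Q1 -(setvU D) setUC measureU// setICr.
move: QDC QD; rewrite -(fineK (prob_fin_num mDC)) -(fineK (prob_fin_num mD)).
rewrite -EFinM -EFinD !lee_fin => QDC [QD].
have : (fine (Q (~` D)) <= 1 / 2)%R.
  by rewrite -(ler_pM2l m0); lra.
lra.
Qed.

End FiniteProbability.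

(** * The minimax argument *)

(** From [expR (- (1 / 2)) >= 1 - 1 / 2] follows [expR (1 / 2) <= 2], which is then squared. *)
Lemma expR1_le4 (R : realType) : expR 1 <= 4 :> R.
Proof.
have h : expR (1 / 2) <= 2 :> R.
  rewrite -[expR _]invrK -expRN -[leRHS]invrK lef_pV2 ?posrE ?expR_gt0 ?invr_gt0//.
  by apply: le_trans (expR_ge1Dx _); lra.
rewrite (_ : 1 = 1 / 2 + 1 / 2 :> R); last by lra.
by rewrite expRD; have := expR_gt0 (1 / 2 : R); nra.
Qed.

Section Resampling.
Context {B : finType} {K : nat}.

Definition resample (b : B) (a : 'I_K) (v : {ffun B -> 'I_K}) : {ffun B -> 'I_K} :=
  [ffun b' => if b' == b then a else v b'].

(** A uniform code stays uniform when one coordinate is drawn afresh: exchanging [v b] with [a] is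
    an involution on the pairs. *)
Lemma sum_resample (R : realType) (b : B) (G : {ffun B -> 'I_K} -> R) :
  \sum_v \sum_a G (resample b a v) = K%:R * \sum_v G v.
Proof.
rewrite pair_big/=.
have -> : K%:R * (\sum_v G v) = \sum_(p : {ffun B -> 'I_K} * 'I_K) G p.1.
  rewrite -(pair_big xpredT xpredT (fun v _ => G v))/= mulr_sumr.
  by apply: eq_bigr => v _; rewrite sumr_const card_ord mulr_natl.
rewrite [RHS](reindex (fun p => (resample b p.2 p.1, p.1 b)))//=.
exists (fun p => (resample b p.2 p.1, p.1 b)) => -[v a] _ /=;
  by rewrite !ffunE eqxx; congr pair; apply/ffunP => b'; rewrite !ffunE;
    case: eqP => // ->.
Qed.

End Resampling.

Lemma product_probability_setT (R : realType) (dS dN : measure_display)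
    (S : measurableType dS) (N : measurableType dN) (PS : probability S R)
    (PN : probability N R) : (PS \x PN)%E [set: S * N] = 1%E.
Proof.
rewrite -setXTT; transitivity (PS setT * PN setT)%E; first exact: product_measure1E.
by rewrite !probability_setT mule1.
Qed.

Section Minimax.
Context {R : realType} {n : nat} {d r : 'I_n -> nat} {Omega : {set mindex d}}.
Context {dN : measure_display} {N : measurableType dN} {PN : probability N R}.
Context {dS : measure_display} {S : measurableType dS} {PS : probability S R}.
Variables (sigma tau : R) (Z : mindex d -> {RV PN >-> R}).
Hypotheses (sigma0 : 0 < sigma) (tau0 : 0 < tau) (ZN : iid_gaussian sigma Z).
Variables (A : S -> observation Omega -> tensor R d) (mA : measurable_algorithm A).
Variable f : forall k, 'I_(d k) -> 'I_(r k).

Local Notation obsType := (g_sigma_algebraType (@cylinders R n d Omega)).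
Local Notation code := {ffun mindex r -> 'I_64}.
Local Notation Q := (PS \x PN)%E.

(* The blocks whose observations do not reveal a shift by [tau]. *)
Definition light (b : mindex r) :=
  (\sum_(i in Omega | block f i == b) 1) * tau ^+ 2 <= sigma ^+ 2.

(** Only light blocks carry a message. The levels are [tau / 64] apart, twice the tolerance of
    [hit], so a guess is within tolerance of at most one of them. *)
Definition signal (v : code) : tensor R d := fun i =>
  if light (block f i) then tau / 64 * (v (block f i))%:R else 0.

Definition hit (v : code) (i : mindex d) : set (S * N) :=
  observed Z (signal v) @^-1`
    [set sy : S * obsType | `|A sy.1 sy.2 i - signal v i| < tau / 128].

Let near_level (i : mindex d) (c : R) : set (S * obsType) :=
  [set sy : S * obsType | `|A sy.1 sy.2 i - c| < tau / 128].

Let measurable_near_level i c : measurable (near_level i c).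
Proof.
rewrite (_ : near_level i c = (fun sy : S * obsType => A sy.1 sy.2 i) @^-1`
    `]c - tau / 128, c + tau / 128[).
  by rewrite -[X in measurable X]setTI; exact: mA.
by apply/seteqP; split => x /=; rewrite /near_level /= in_itv/= ltr_distl.
Qed.

Lemma measurable_hit v i : measurable (hit v i).
Proof.
rewrite -[X in measurable X]setTI.
apply: (measurable_observed (PN := PN)) => //; exact: measurable_near_level.
Qed.

Let Q1 : Q [set: S * N] = 1%E.
Proof. exact: product_probability_setT. Qed.

(** Every level of the block is compared with level 0. Under the reference code [v0] the 64 hit
    events are disjoint, so the sum is at most [8 * 1 + 64 / 8], a quarter of 64. *)
Lemma sum_hit_resample (v : code) i : light (block f i) ->
  \sum_a fine (Q (hit (resample (block f i) a v) i)) <= 16.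
Proof.
move=> li; set b := block f i.
pose v0 := resample b ord0 v.
pose E (a : 'I_64) := observed Z (signal v0) @^-1` near_level i (tau / 64 * a%:R).
have mE a : measurable (E a).
  rewrite -[X in measurable X]setTI.
  apply: (measurable_observed (PN := PN)) => //; exact: measurable_near_level.
(* The change of measure is used with [lam = 8], the minimizer of [lam + 64 / lam]; its second term
   is at most [expR 1 / 32], hence at most [4 / 32]. *)
have hitE a : fine (Q (hit (resample b a v) i)) <= 8 * fine (Q (E a)) + 1 / 8.
  have sigE : signal (resample b a v) i = tau / 64 * a%:R.
    by rewrite /signal -/b li ffunE eqxx.
  have := @seeded_change_of_measure _ _ _ Omega _ _ PN sigma Z sigma0 ZN _ _ PS
    (signal v0) (signal (resample b a v)) 8 _ _ (measurable_near_level i (tau / 64 * a%:R)).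
  have hitQ : observed Z (signal (resample b a v)) @^-1` near_level i (tau / 64 * a%:R) =
      hit (resample b a v) i by rewrite /hit sigE.
  rewrite hitQ -(fineK (prob_fin_num Q1 (measurable_hit _ _))).
  rewrite -/(E a) -[X in (_ * X)%E](fineK (prob_fin_num Q1 (mE a))).
  rewrite -EFinM -EFinD lee_fin => /(_ (ltr0n R 8)) /le_trans; apply; rewrite lerD2l.
  (* The two signals differ only on block [b], by at most [tau], and lightness bounds the number of
     observations there. *)
  have diff : \sum_(j in Omega) ((signal (resample b a v) j - signal v0 j) / sigma) ^+ 2 <= 1.
    rewrite (eq_bigr (fun j => if block f j == b then (tau / 64 * a%:R / sigma) ^+ 2 else 0)).
      rewrite -big_mkcondr/=.
      apply: (@le_trans _ _ (\sum_(j in Omega | block f j == b) (tau / sigma) ^+ 2)).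
        apply: ler_sum => j _.
        rewrite lerXn2r ?nnegrE ?mulr_ge0 ?invr_ge0 ?(ltW sigma0) ?(ltW tau0)//.
        rewrite ler_pM2r ?invr_gt0// -mulrA ler_piMr ?(ltW tau0)//.
        rewrite mulrC ler_pdivrMr// mul1r ler_nat.
        exact: ltnW (ltn_ord a).
      rewrite (eq_bigr (fun=> (tau / sigma) ^+ 2 * 1)); last by move=> j _; rewrite mulr1.
      by rewrite -mulr_sumr expr_div_n mulrAC ler_pdivrMr ?exprn_gt0// mul1r mulrC.
    move=> j _; rewrite /signal; case: (eqVneq (block f j) b) => [->|jb].
      by rewrite li !ffunE eqxx mulr0 subr0.
    by rewrite !ffunE (negbTE jb) subrr mul0r expr0n.
  have : expR (\sum_(j in Omega) ((signal (resample b a v) j - signal v0 j) / sigma) ^+ 2) <= 4.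
    by apply: le_trans (expR1_le4 R); rewrite ler_expR.
  by move: (expR _) => e; lra.
apply: (@le_trans _ _ (\sum_(a < 64) (8 * fine (Q (E a)) + 1 / 8))).
  by apply: ler_sum => a _; exact: hitE.
rewrite big_split/= -mulr_sumr sumr_const card_ord -mulr_natr.
suff : \sum_(a < 64) fine (Q (E a)) <= 1 by lra.
rewrite -lee_fin -sumEFin.
rewrite (eq_bigr (fun a => Q (E a))) => [|a _]; last first.
  by rewrite fineK//; apply: prob_fin_num.
apply: (sum_prob_disjoint Q1) => // a a' [x [/= Ea Ea']].
(* The two tolerances add up to one gap between levels, so a common guess forces [a1 < a2 + 1]. *)
have le a1 a2 : E a1 x -> E a2 x -> (a1 <= a2)%N.
  rewrite /E /near_level/= !ltr_distl => /andP[h1 _] /andP[_ h2].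
  have h : tau / 64 * a1%:R < tau / 64 * (a2%:R + 1) by lra.
  by move: h; rewrite ltr_pM2l ?divr_gt0// natr1 ltr_nat ltnS.
by apply/val_inj/eqP; rewrite eqn_leq !le.
Qed.

(** By resampling the level of its block, each light entry is hit with probability at most [16 / 64]
    on average over the codes; some code does no worse than the average. *)
Lemma exists_code (W : mindex d -> R) (mG := \sum_(i | light (block f i)) W i) :
  (forall i, 0 <= W i) ->
  exists v, \sum_(i | light (block f i)) W i * fine (Q (hit v i)) <= mG / 4.
Proof.
move=> W0; apply: contrapT => /forallNP lt_mG.
have : \sum_(v : code) mG / 4 <
    \sum_(v : code) \sum_(i | light (block f i)) W i * fine (Q (hit v i)).
  apply: ltr_sum => [|v _]; last by rewrite ltNge; apply/negP/lt_mG.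
  by apply/hasP; exists [ffun=> ord0] => //; rewrite mem_index_enum.
have sumE : \sum_(v : code) mG / 4 = mG / 4 * #|{: code}|%:R.
  by rewrite sumr_const mulr_natr.
apply/negP; rewrite -leNgt exchange_big/= sumE mulrAC.
rewrite /mG mulr_suml mulr_suml; apply: ler_sum => i li.
rewrite -mulr_sumr -mulrA ler_wpM2l//.
have := sum_resample (block f i) (fun v => fine (Q (hit v i))).
have : \sum_v \sum_a fine (Q (hit (resample (block f i) a v) i)) <= \sum_(v : code) 16.
  by apply: ler_sum => v _; exact: sum_hit_resample.
have -> : \sum_(v : code) (16 : R) = 16 * #|{: code}|%:R.
  by rewrite sumr_const mulr_natr.
by move=> h16 h64; rewrite h64 in h16; lra.
Qed.

Lemma normoo_signal v : normoo (signal v) <= tau.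
Proof.
apply: bigmax_le => [|i _]; first exact: ltW.
rewrite /signal; case: ifP => _; last by rewrite normr0 ltW.
rewrite ger0_norm ?mulr_ge0 ?divr_ge0 ?(ltW tau0)//.
rewrite -mulrA ler_piMr ?(ltW tau0)// mulrC ler_pdivrMr// mul1r ler_nat.
exact: ltnW (ltn_ord _).
Qed.

Lemma tucker_cone_signal v : tucker_cone r (signal v).
Proof.
by apply: (@tucker_cone_block _ _ _ _ _ f
  (fun b => if light b then tau / 64 * (v b)%:R else 0)).
Qed.

Definition sqr_loss (W : tensor R d) (T : tensor R d) (x : S * N) :=
  \sum_i W i * (A x.1 (restr Omega T \+ restr Omega (Z ^~ x.2)) i - T i) ^+ 2.

Lemma measurable_sqr_loss W T : measurable_fun [set: S * N] (sqr_loss W T).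
Proof.
apply: measurable_sum => i; apply: measurable_funM => //; apply: measurable_funX.
apply: measurable_funB => //.
exact: (measurableT_comp (mA i) (measurable_observed Z T)).
Qed.

(** A light entry that is not hit costs at least [(tau / 128) ^+ 2 * W i], and with probability at
    least 1/2 such entries carry at least half of the light mass. *)
Lemma minimax_sqr_loss (W : tensor R d) (mG := \sum_(i | light (block f i)) W i)
    (kappa : \bar R) (D : R) :
  (forall i, 0 <= W i) -> 0 < mG -> 0 < D ->
  (kappa <= (Num.sqrt ((tau / 128) ^+ 2 * (mG / 2)) / D)%:E)%E ->
  exists T, (tucker_cone r `&` ball_oo tau) T /\
    ((1 / 2)%:E <= Q [set x | kappa <= (Num.sqrt (sqr_loss W T x) / D)%:E])%E.
Proof.
move=> W0 mG0 D0 kD; have [v hv] := exists_code W0.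
exists (signal v); split.
  by split; [exact: tucker_cone_signal|exact: normoo_signal].
have := prob_mass_ge_half Q1 W0 (measurable_hit v) mG0 hv.
move=> /le_trans; apply; apply: le_measure; rewrite ?inE.
- rewrite -[X in measurable X]setTI.
  rewrite (_ : [set _ | _] = (fun x => \sum_(i | light (block f i)) W i * \1_(hit v i) x)
    @^-1` `]-oo, mG / 2]); last by apply/seteqP; split => x /=; rewrite in_itv.
  by apply: measurable_mass => // i; exact: measurable_hit.
- rewrite -[X in measurable X]setTI; apply: measurable_lee => //.
  apply/measurable_EFinP/measurable_funM => //.
  apply: measurableT_comp; last exact: measurable_sqr_loss.
  by apply: continuous_measurable_fun; exact: sqrt_continuous.
move=> x /= hx; apply: (le_trans kD); rewrite lee_fin ler_pM2r ?invr_gt0//.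
rewrite ler_wsqrtr//.
apply: (@le_trans _ _ (\sum_(i | light (block f i))
  W i * (A x.1 (restr Omega (signal v) \+ restr Omega (Z ^~ x.2)) i - signal v i) ^+ 2));
  last first.
  rewrite /sqr_loss [leRHS](bigID (fun i => light (block f i)))/= lerDl.
  by apply: sumr_ge0 => i _; rewrite mulr_ge0 ?sqr_ge0.
apply: (@le_trans _ _ ((tau / 128) ^+ 2 *
  (mG - \sum_(i | light (block f i)) W i * \1_(hit v i) x))).
  by rewrite ler_wpM2l ?sqr_ge0//; move: hx; rewrite -/mG; lra.
rewrite -sumrB mulr_sumr; apply: ler_sum => i _.
rewrite -[X in X - _]mulr1 -mulrBr mulrCA ler_wpM2l// indicE.
have [_|] := boolP (x \in _); first by rewrite subrr mulr0 sqr_ge0.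
rewrite notin_setE subr0 mulr1 /hit /= => /negP; rewrite -leNgt => h.
by rewrite -[leRHS]real_normK ?num_real// lerXn2r ?nnegrE ?divr_ge0 ?(ltW tau0).
Qed.

End Minimax.

(** * The lower bound *)

Lemma frob_hpow_half_mul (R : realType) (n : nat) (d : 'I_n -> nat) (W U : tensor R d) :
  (forall i, 0 <= W i) ->
  frob (hpow W (1 / 2) \* U) = Num.sqrt (\sum_i W i * U i ^+ 2).
Proof.
move=> W0; congr Num.sqrt; apply: eq_bigr => i _.
by rewrite /= /hpow div1r exprMn powR12_sqrt// sqr_sqrtr.
Qed.

Lemma frob_hpow_half (R : realType) (n : nat) (d : 'I_n -> nat) (W : tensor R d) :
  (forall i, 0 <= W i) -> frob (hpow W (1 / 2)) = Num.sqrt (\sum_i W i).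
Proof.
move=> W0; congr Num.sqrt; apply: eq_bigr => i _.
by rewrite /= /hpow div1r powR12_sqrt// sqr_sqrtr.
Qed.

(** If [X <= 2] then [1 <= 2 / X]; otherwise [X - 1 >= X / 2], and the first entry of the minimum is
    small enough. *)
Lemma le_Mfactor (R : realType) (C' : R) (n : nat) (d r : 'I_n -> nat)
    (X := \prod_k (1 + 2 * C' ^+ 2 * ((r k)%:R / (d k)%:R))) :
  1 <= X -> (Mfactor C' d r <= (Num.sqrt (2 / X))%:E)%E.
Proof.
move=> X1; have X0 : 0 < X by apply: lt_le_trans X1.
rewrite /Mfactor -/X; have [X2|X2] := leP X 2.
  rewrite !ge_min; apply/orP; right; apply/orP; left.
  by rewrite lee_fin -[leLHS]sqrtr1 ler_wsqrtr// ler_pdivlMr// mul1r.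
rewrite !ge_min; apply/orP; left.
rewrite div1e inver subr_eq0 gt_eqF; last by lra.
rewrite lee_fin ler_wsqrtr// ler_pdivlMr// mulrC ler_pdivrMr; lra.
Qed.

Lemma sampling_prob_ge0_empty (R : realType) (n : nat) (d : 'I_n -> nat) (W : tensor R d) E :
  (mindex d -> False) -> 0 <= sampling_prob W E.
Proof.
move=> noi; apply: sumr_ge0 => Om _.
by rewrite mulr_ge0// prodr_ge0// => i; case: (noi i).
Qed.

Lemma minimax_lower_bound (R : realType) (C' : R) (n : nat) (d r : 'I_n -> nat)
    (w : forall k : 'I_n, 'I_(d k) -> R) (W := outer w) (i0 : mindex d)
    (Omega : {set mindex d}) (sigma beta : R) (kappa : \bar R) :
  0 < C' -> (forall i, 0 < W i) ->
  (forall k, max_abs (w k) <= C' * min_abs (w k)) ->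
  0 < sigma -> 0 < beta ->
  (kappa <= (1 / 512)%:E * mine
     (beta / Num.sqrt (ln (8 * \prod_k (d k)%:R)))%:E
     (sigma%:E / (Num.sqrt #|Omega|%:R)%:E
        * (Num.sqrt (\prod_k (r k)%:R))%:E * Mfactor C' d r))%E ->
  forall (dS : measure_display) (Seed : measurableType dS)
    (PS : probability Seed R) (A : Seed -> observation Omega -> tensor R d),
  measurable_algorithm A ->
  forall (dN : measure_display) (N : measurableType dN)
    (PN : probability N R) (Z : mindex d -> {RV PN >-> R}),
  iid_gaussian sigma Z ->
  exists T : tensor R d, (tucker_cone r `&` ball_oo beta) T /\
    ((1 / 2)%:E <= (PS \x PN) [set x : Seed * N | kappa <=
      (Num.sqrt (\sum_i W i * (A x.1 (restr Omega T \+ restr Omega (Z ^~ x.2)) i - T i) ^+ 2)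
       / Num.sqrt (\sum_i W i))%:E])%E.
Proof.
move=> C'0 W0 wC s0 b0 hk dS S PS A mA dN N PN Z ZN.
have W0' i : 0 <= W i by exact: ltW.
have m0 : 0 < \sum_i W i.
  by rewrite (bigD1 i0)//= ltr_wpDr// sumr_ge0.
have [[k rk0]|r0] := pselect (exists k, r k = 0%N).
  (* A zero rank makes the second rate 0, even for empty [Omega] since [+oo * 0 = 0], and the zero
     tensor serves. *)
  have kappa0 : (kappa <= 0)%E.
    apply: (le_trans hk); apply: mule_ge0_le0; first by rewrite lee_fin; lra.
    rewrite ge_min; apply/orP; right.
    by rewrite (bigD1 k)//= rk0 mul0r sqrtr0 mule0 mul0e.
  exists (fun=> 0); split.
    split; last by apply: bigmax_le => [|i _]; rewrite ?normr0 ltW.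
    move=> j; rewrite (_ : unfolding _ _ = 0) ?mxrank0//.
    by apply/matrixP => a c; rewrite !mxE.
  rewrite (_ : [set _ | _] = setT).
    by rewrite product_probability_setT lee_fin; lra.
  apply/seteqP; split => // x _ /=; apply: (le_trans kappa0).
  by rewrite lee_fin divr_ge0 ?sqrtr_ge0.
have {}r0 k : (0 < r k)%N.
  by rewrite lt0n; apply/eqP => rk0; apply: r0; exists k.
have d0 k : (0 < d k)%N by exact: leq_ltn_trans (ltn_ord (i0 k)).
have [f fb] := balanced_blocks i0 C'0 W0 wC r0.
set X := \prod_k (1 + _) in fb; set rho := \prod_k (r k)%:R in fb.
have rho0 : 0 < rho by apply: prodr_gt0 => k _; rewrite ltr0n.
have X1 : 1 <= X.
  apply: (@le_trans _ _ (\prod_(k < n) 1)); first by rewrite big1.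
  apply: ler_prod => k _; rewrite ler01 lerDl.
  by rewrite mulr_ge0 ?divr_ge0// mulr_ge0// sqr_ge0.
have X0 : 0 < X by apply: lt_le_trans X1.
(* The 256 arises from [tau / 128] and a square root of 1/4: light blocks hold half of the mass, and
   half of that is missed. *)
suff [tau [tau0 taub tauO ktau]] : exists tau, [/\ 0 < tau, tau <= beta,
    2 * (#|Omega|%:R * tau ^+ 2) * X <= sigma ^+ 2 * rho & (kappa <= (tau / 256)%:E)%E].
  have V0 : 0 <= X * (\sum_i W i) / rho.
    by rewrite divr_ge0 ?mulr_ge0 ?ltW.
  have mGm := light_blocks s0 V0 fb (Om := Omega) (tau := tau) _.
  have {}mGm : (\sum_i W i) / 2 <= \sum_(i | light sigma tau (Omega := Omega) f (block f i)) W i.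
    apply: mGm; rewrite [leLHS]mulrA ler_pdivrMr//.
    by rewrite [leLHS]mulrA [leRHS]mulrAC ler_pM2r.
  have [|||T [[Tr Tb] hT]] := @minimax_sqr_loss _ _ _ _ Omega _ _ _ _ _ PS
    sigma tau Z s0 tau0 ZN A mA f W kappa (Num.sqrt (\sum_i W i)) W0'.
  - by apply: lt_le_trans mGm; rewrite divr_gt0.
  - by rewrite sqrtr_gt0.
  - apply: (le_trans ktau); rewrite lee_fin.
    rewrite ler_pdivlMr ?sqrtr_gt0//.
    have t0 : 0 <= tau / 256 by rewrite divr_ge0// ltW.
    rewrite (_ : tau / 128 = 2 * (tau / 256)); last by field.
    move: (tau / 256) t0 => t t0.
    rewrite -[X in X * _]ger0_norm// -sqrtr_sqr -sqrtrM ?sqr_ge0// ler_wsqrtr//.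
    rewrite exprMn -[leRHS]mulrA [leRHS]mulrCA; apply: ler_wpM2l; first exact: sqr_ge0.
    move: mGm; rewrite ler_pdivrMr// => /le_trans; apply.
    by rewrite le_eqVlt; apply/orP; left; apply/eqP; field.
  exists T; split; first by split => //; exact: le_trans Tb taub.
  exact: hT.
(* Since [expR 1 <= 4 <= 8], the first rate is at most [beta]. *)
have lnD : 1 <= Num.sqrt (ln (8 * \prod_k (d k)%:R)) :> R.
  have D1 : 1 <= \prod_k (d k)%:R :> R.
    apply: (@le_trans _ _ (\prod_(k < n) 1)); first by rewrite big1.
    by apply: ler_prod => k _; rewrite ler01 ler1n d0.
  move: (\prod_k _) D1 => D D1.
  rewrite -[leLHS]sqrtr1 ler_wsqrtr// -[leLHS]expRK ler_ln ?posrE ?expR_gt0//; last by lra.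
  by apply: (le_trans (expR1_le4 R)); lra.
have hb : (kappa <= ((1 / 512) * beta)%:E)%E.
  apply: (le_trans hk); rewrite (EFinM (1 / 512)) lee_wpmul2l//.
  rewrite ge_min lee_fin; apply/orP; left.
  by rewrite ler_pdivrMr ?(lt_le_trans ltr01)// ler_peMr// ltW.
(* With no observations the counting condition is void and [tau = beta] is allowed; the formula for
   [s] would divide by 0. *)
have [omE|omE] := posnP #|Omega|.
  exists beta; split=> //.
    by rewrite omE mul0r mulr0 mul0r mulr_ge0 ?sqr_ge0// ltW.
  by apply: (le_trans hb); rewrite lee_fin; lra.
have om0 : 0 < #|Omega|%:R :> R by rewrite ltr0n.
(* The largest [tau] that the counting condition admits, where it holds with equality. *)
pose s := sigma * Num.sqrt (rho / (2 * X * #|Omega|%:R)).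
have ss0 : 0 < s.
  by rewrite mulr_gt0// sqrtr_gt0 divr_gt0// mulr_gt0// mulr_gt0.
exists (Num.min beta s); split.
- by rewrite lt_min b0.
- by rewrite ge_min lexx.
- apply: (@le_trans _ _ (2 * (#|Omega|%:R * s ^+ 2) * X)).
    rewrite ler_wpM2r ?(ltW X0)// ler_wpM2l// ler_wpM2l ?(ltW om0)//.
    by rewrite lerXn2r ?nnegrE ?le_min ?ge_min ?lexx ?orbT ?(ltW b0) ?(ltW ss0).
  rewrite /s exprMn sqr_sqrtr; last first.
    by rewrite divr_ge0 ?(ltW rho0)// !mulr_ge0 ?(ltW X0) ?(ltW om0).
  by rewrite le_eqVlt; apply/orP; left; apply/eqP; field; rewrite !gt_eqF.
- rewrite minr_pMl ?invr_ge0// EFin_min le_min; apply/andP; split.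
    by apply: (le_trans hb); rewrite lee_fin; lra.
  (* By [le_Mfactor] this bounds the second rate, whence the constant: [2 * s / 512 = s / 256]. *)
  have two_s : sigma / Num.sqrt #|Omega|%:R * Num.sqrt rho * Num.sqrt (2 / X) = 2 * s.
    rewrite /s mulrCA -!mulrA; congr (_ * _).
    rewrite -[X in X * Num.sqrt (rho / _)](@ger0_norm R)// -sqrtr_sqr.
    rewrite -sqrtrV ?(ltW om0)// -!sqrtrM ?sqr_ge0 ?invr_ge0 ?(ltW om0) ?(ltW rho0)//.
    by congr Num.sqrt; field; rewrite !gt_eqF.
  apply: (le_trans hk).
  rewrite (_ : s / 256 = 1 / 512 * (2 * s)); last by field.
  rewrite (EFinM (1 / 512)) lee_wpmul2l//.
  rewrite ge_min; apply/orP; right.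
  rewrite inver gt_eqF ?sqrtr_gt0// -!EFinM -two_s [leRHS]EFinM.
  apply: lee_wpmul2l.
    by rewrite lee_fin !mulr_ge0 ?sqrtr_ge0 ?invr_ge0 ?sqrtr_ge0// ltW.
  exact: le_Mfactor.
Qed.

Theorem theoremB11 (R : realType) (C' : R) (hC' : 0 < C') :
  exists c C : R, 0 < c /\ 0 < C /\
  forall (n : nat) (d : 'I_n -> nat) (w : forall k : 'I_n, 'I_(d k) -> R),
  let W : tensor R d := outer w in
  (forall i, 0 < W i) ->
  normoo W <= 1 ->
  (forall k, max_abs (w k) <= C' * min_abs (w k)) ->
  let m := frob (hpow W (1 / 2)) ^+ 2 in
  1 - expR (- (C * m)) <= sampling_prob W [set Omega |
    forall (sigma beta : R) (r : 'I_n -> nat), 0 < sigma -> 0 < beta ->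
    forall (dS : measure_display) (Seed : measurableType dS)
      (PS : probability Seed R) (A : Seed -> observation Omega -> tensor R d),
    measurable_algorithm A ->
    forall (dN : measure_display) (N : measurableType dN)
      (PN : probability N R) (Z : mindex d -> {RV PN >-> R}),
    iid_gaussian sigma Z ->
    exists T : tensor R d, (tucker_cone r `&` ball_oo beta) T /\
      ((1 / 2)%:E <= (PS \x PN) [set x : Seed * N |
        c%:E * mine
          (beta / Num.sqrt (ln (8 * \prod_k (d k)%:R)))%:E
          (sigma%:E / (Num.sqrt #|Omega|%:R)%:E
             * (Num.sqrt (\prod_k (r k)%:R))%:E * Mfactor C' d r)
        <= (frob (hpow W (1 / 2) \*
                  (A x.1 (restr Omega T \+ restr Omega (Z ^~ x.2)) \- T))
            / frob (hpow W (1 / 2)))%:E])%E].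
Proof.
(* Any positive [C] would serve: if there are multi-indices the event holds for every [Omega], and
   otherwise [m = 0] and the claimed probability is 0. *)
exists (1 / 512), 1; split; first by rewrite divr_gt0.
split=> [|n d w W W0 _ wC]; first exact: ltr01.
lazy zeta; set m := frob _ ^+ 2.
have W0' i : 0 <= W i by exact: ltW.
have [[i0 _]|noi] := pselect (exists i : mindex d, True); last first.
  have no (i : mindex d) : False by apply: noi; exists i.
  rewrite (_ : m = 0).
    by rewrite mulr0 oppr0 expR0 subrr sampling_prob_ge0_empty.
  by rewrite /m frob_hpow_half// big1 ?sqrtr0 ?expr0n// => i; case: (no i).
rewrite [X in sampling_prob _ X](_ : _ = setT).
  by rewrite sampling_prob_setT lerBlDr lerDl expR_ge0.
apply/seteqP; split => // Omega _ /= sigma beta r s0 b0 dS S PS A mA dN N PN Z ZN.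
have [T [TK hT]] := @minimax_lower_bound R C' n d r w i0 Omega
  sigma beta _ hC' W0 wC s0 b0 (lexx _) _ _ PS A mA _ _ PN Z ZN.
exists T; split=> //; rewrite frob_hpow_half//.
under eq_set => x do rewrite (frob_hpow_half_mul _ W0').
exact: hT.
Qed.
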